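(* Let $N\ge2$. Then the following statements hold: (i) The system $\mathcal R_{1,N}$ is robust to 1 erasure. (ii) For odd $d$ (where $N=2d$), the system $\mathcal R_{2,N}$ is robust to 1 erasure.
   Context: $\ell^2(\mathbb Z_N)$ is the $N$-dimensional complex Hilbert space of functions on $\mathbb Z_N=\{0,1,\dots,N-1\}$ (identified with $N$-periodic functions on $\mathbb Z$), with $\langle x,y\rangle=\sum_{n=0}^{N-1}x(n)\overline{y(n)}$. For $m\in\mathbb Z$, the circular shift is $L_mx(n)=x(n-m)$. For a positive integer $q$, the $q$-th Ramanujan sum is $c_q(n)=\sum_{1\le k\le q,\,(k,q)=1}e^{2\pi i kn/q}$; it is $q$-periodic, so for $q\mid N$ it is regarded as an element of $\ell^2(\mathbb Z_N)$. For $N=pd$ ($p,d$ positive integers) with positive divisors $q_1,\dots,q_K$, $\mathcal R_{p,N}$ denotes the family $(L_{pk}c_{q_i})$ indexed by $(k,i)\in\{0,\dots,d-1\}\times\{1,\dots,K\}$. A finite family $(f_j)$ in a finite-dimensional Hilbert space $H$ is a frame for $H$ if there are constants $A,B>0$ with $A\|x\|^2\le\sum_j|\langle x,f_j\rangle|^2\le B\|x\|^2$ for all $x\in H$. The family $\mathcal R_{p,N}$ is robust to $e$ erasures if, for every set $\mathcal I$ of $e$ indices $(k,i)$, the family obtained by deleting the members with index in $\mathcal I$ is still a frame for $\ell^2(\mathbb Z_N)$.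
   Formalization: Part (ii) is stated for odd d > 1: for d = 1 (N = 2) it fails, since the system consists only of c_1 = (1,1) and c_2 = (1,-1), and after one erasure a single vector cannot be a frame for a 2-dimensional space. *)

(* Defs.v *)
From HB Require Import structures.
From mathcomp Require Import all_boot all_order all_algebra.
From mathcomp Require Import sesquilinear spectral.
From mathcomp Require Import complex.
From mathcomp Require Import all_classical all_reals all_analysis.

Set Implicit Arguments.
Unset Strict Implicit.
Unset Printing Implicit Defensive.

Import Order.TTheory GRing.Theory Num.Theory.
Local Open Scope ring_scope.
Local Open Scope complex_scope.

(* The Hilbert space l^2(Z_N) is the space of row vectors 'rV[R[i]]_N, with the
   inner product dotmx x y = \sum_n x 0 n * (y 0 n)^* of spectral.v, which is
   linear in its first argument. *)

Definition expi (R : realType) (t : R) : R[i] := cos t +i* sin t.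

Definition ramanujan_sum (R : realType) (q : nat) (n : int) : R[i] :=
  \sum_(1 <= k < q.+1 | coprime k q)
     expi (2 * pi * k%:R * n%:~R / q%:R).

Definition ramanujan_vec (R : realType) (N q : nat) : 'rV[R[i]]_N :=
  \row_(n < N) ramanujan_sum R q n%:Z.

Lemma residue_subproof (N : nat) (n : 'I_N) (m : int) :
  (`|(m %% N)%Z| < N)%N.
Proof.
have N_gt0 : (0 < N)%N := leq_ltn_trans (leq0n n) (ltn_ord n).
by rewrite -ltz_nat gez0_abs ?ltz_pmod ?modz_ge0 // eqz_nat -lt0n.
Qed.

(* The residue of m in {0, ..., N-1}; the element n of 'I_N only serves to
   witness that 0 < N. *)
Definition residue (N : nat) (n : 'I_N) (m : int) : 'I_N :=
  Ordinal (residue_subproof n m).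

Definition circ_shift (R : realType) (N : nat) (m : int) (x : 'rV[R[i]]_N) :
    'rV[R[i]]_N :=
  \row_(n < N) x 0 (residue n (n%:Z - m)).

(* dotmx x x is the squared norm of x.  The inequalities are those of the
   partial order of R[i], for which z <= w forces w - z to be real. *)
Definition is_frame (R : realType) (N : nat) (J : finType)
    (f : J -> 'rV[R[i]]_N) : Prop :=
  exists A B : R, [/\ 0 < A, 0 < B &
    forall x : 'rV[R[i]]_N,
      A%:C * dotmx x x <= \sum_(j : J) `|dotmx x (f j)| ^+ 2 /\
      \sum_(j : J) `|dotmx x (f j)| ^+ 2 <= B%:C * dotmx x x].

Definition robust_to_erasures (R : realType) (N : nat) (J : finType)
    (f : J -> 'rV[R[i]]_N) (e : nat) : Prop :=
  forall I : {set J}, #|I| = e ->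
    is_frame (fun j : {j : J | j \notin I} => f (val j)).

(* For p dividing N, so that d = N %/ p; the divisors of N are listed by
   "divisors N", in increasing order and without repetition. *)
Definition ramanujan_system (R : realType) (p N : nat)
    (ki : 'I_(N %/ p) * 'I_(size (divisors N))) : 'rV[R[i]]_N :=
  circ_shift (p * ki.1)%N%:Z
    (ramanujan_vec R N (tnth (in_tuple (divisors N)) ki.2)).

(* Main.v *)
(** The shifts of c_q see exactly the discrete Fourier coefficients of x at the
    frequencies of exact order q in Z_N: the inner product of x with L_{pk} c_q,
    as a function of k in Z_d (d = N / p), is a trigonometric polynomial whose
    spectrum is the image of these frequencies in Z_d.  When this reduction
    modulo d is injective on frequencies of order q (trivially for p = 1; by
    parity for p = 2 and d odd), the polynomial determines the coefficients.
    Since d > 1 the spectrum always misses some element of Z_d: 1 if q divides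
    p, and 0 otherwise.  A function on Z_d that vanishes off one point has a
    Fourier transform of constant modulus, so with a missing frequency it is
    zero: the one erased value is recovered from the others. *)

Require Import Defs.
From mathcomp Require Import all_boot all_order all_algebra.
From mathcomp Require Import sesquilinear spectral complex.
From mathcomp Require Import all_classical all_reals all_analysis.
From mathcomp Require Import ring lra.

Set Implicit Arguments.
Unset Strict Implicit.
Unset Printing Implicit Defensive.

Import Order.TTheory GRing.Theory Num.Theory.
Local Open Scope complex_scope.
Local Open Scope ring_scope.

(** * Norms and the frame property of complete families *)

Lemma dotmx_sum (C : numClosedFieldType) (n : nat) (u v : 'rV[C]_n) :
  dotmx u v = \sum_(j < n) u 0 j * (v 0 j)^*.
Proof. by rewrite dotmxE mxE; apply: eq_bigr => j _; rewrite !mxE. Qed.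

Lemma dnorm_sum (C : numClosedFieldType) (n : nat) (u : 'rV[C]_n) :
  dotmx u u = \sum_(j < n) `|u 0 j| ^+ 2.
Proof. by rewrite dotmx_sum; apply: eq_bigr => j _; rewrite normCK. Qed.

(** Cauchy-Schwarz on each column: the squared operator norm is at most the squared Frobenius norm
    [S]. *)
Lemma mulmx_bounded (R : realType) (m n : nat) (M : 'M[R[i]]_(m, n)) :
  exists2 K : R, 0 < K &
    forall x : 'rV[R[i]]_m, dotmx (x *m M) (x *m M) <= K%:C * dotmx x x.
Proof.
pose col_conj j : 'rV[R[i]]_m := \row_i (M i j)^*.
pose S : R[i] := \sum_(j < n) dotmx (col_conj j) (col_conj j).
have S_ge0 : 0 <= S by apply: sumr_ge0 => j _; exact: dnorm_ge0.
(* The added 1 keeps the constant positive when [M] is zero. *)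
exists (complex.Re S + 1).
  by rewrite ltr_wpDl ?ltr01 //; move: S_ge0; rewrite lecE => /andP[].
move=> x.
have -> : (complex.Re S + 1)%:C = S + 1.
  by rewrite rmorphD /= RRe_real // ger0_real.
apply: (@le_trans _ _ (S * dotmx x x)); last first.
  by rewrite ler_wpM2r ?dnorm_ge0 // lerDl ler01.
rewrite dnorm_sum mulr_suml; apply: ler_sum => j _.
have -> : (x *m M) 0 j = dotmx x (col_conj j).
  by rewrite dotmx_sum mxE; apply: eq_bigr => i _; rewrite mxE conjCK.
by rewrite mulrC (CauchySchwarz (@dotmx R[i] m)).
Qed.

(* The analysis map of a complete family is injective on a finite-dimensional
   space, so it has a bounded linear left inverse: this is the lower frame
   bound. *)
Lemma complete_is_frame (R : realType) (N : nat) (J : finType)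
    (f : J -> 'rV[R[i]]_N) :
  (forall x, (forall j, dotmx x (f j) = 0) -> x = 0) -> is_frame f.
Proof.
move=> complete_f.
pose F : 'M[R[i]]_(N, #|J|) := \matrix_(n, j) (f (enum_val j) 0 n)^*.
have mulF x j : (x *m F) 0 j = dotmx x (f (enum_val j)).
  by rewrite dotmx_sum mxE; apply: eq_bigr => n _; rewrite mxE.
have dnormF x : \sum_j `|dotmx x (f j)| ^+ 2 = dotmx (x *m F) (x *m F).
  rewrite dnorm_sum (reindex (@enum_val J predT)) /=; last first.
    exact/onW_bij/enum_val_bij.
  by apply: eq_bigr => j _; rewrite mulF.
have /row_freeP[G FG1] : row_free F.
  apply: inj_row_free => x xF0; apply: complete_f => j.
  by have := mulF x (enum_rank j); rewrite enum_rankK xF0 mxE.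
have [B B_gt0 leB] := mulmx_bounded F.
have [K K_gt0 leK] := mulmx_bounded G.
exists K^-1, B; split => //; first by rewrite invr_gt0.
move=> x; rewrite dnormF; split; last exact: leB.
have := leK (x *m F); rewrite -mulmxA FG1 mulmx1 => leKx.
have K_unit : K%:C * (K^-1)%:C = 1 :> R[i].
  by rewrite -rmorphM /= divff ?gt_eqF.
have Kinv_ge0 : 0 <= (K^-1)%:C :> R[i] by rewrite ler0c invr_ge0 ltW.
apply: le_trans (ler_wpM2l Kinv_ge0 leKx) _.
by rewrite mulrA [X in X * _]mulrC K_unit mul1r.
Qed.

(** * Fourier analysis with a primitive root of unity *)

Section RootsOfUnity.
Variables (C : numClosedFieldType) (d : nat) (z : C).
Hypothesis prim_z : d.-primitive_root z.

Lemma prim_root_norm : `|z| = 1.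
Proof.
apply/eqP; rewrite -(@pexpr_eq1 _ _ d) ?(prim_order_gt0 prim_z) //.
by rewrite -normrX (prim_expr_order prim_z) normr1.
Qed.

Lemma prim_root_expr_mulconj (i : nat) : z ^+ i * (z ^+ i)^* = 1.
Proof. by rewrite -normCK normrX prim_root_norm !expr1n. Qed.

Lemma prim_root_orthogonal (i j : nat) :
  \sum_(k < d) z ^+ (i * k) * (z ^+ (j * k))^* =
    if (i == j %[mod d])%N then d%:R else 0.
Proof.
(* The sum is geometric with ratio [y], a [d]-th root of unity that is 1 exactly when [i] and [j]
   agree modulo [d]. *)
pose y := z ^+ i * (z ^+ j)^*.
have -> : \sum_(k < d) z ^+ (i * k) * (z ^+ (j * k))^* = \sum_(k < d) y ^+ k.
  by apply: eq_bigr => k _; rewrite exprMn !exprM rmorphXn.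
have y1E : (y == 1) = (i == j %[mod d])%N.
  rewrite -(eq_prim_root_expr prim_z); apply/eqP/eqP => [y1|eq_ij]; last first.
    by rewrite /y eq_ij prim_root_expr_mulconj.
  by rewrite -[LHS]mulr1 -(prim_root_expr_mulconj j) mulrCA -/y y1 mulr1.
have [/eqP y1|y_neq1] := boolP (y == 1); rewrite -y1E.
  rewrite y1 eqxx (eq_bigr (fun=> 1)) => [|k _]; last by rewrite expr1n.
  by rewrite sumr_const card_ord.
rewrite (negPf y_neq1); apply: (mulfI (_ : y - 1 != 0)).
  by rewrite subr_eq0.
rewrite -subrX1 mulr0 exprMn -rmorphXn /= (exprAC _ i) (exprAC _ j).
by rewrite (prim_expr_order prim_z) !expr1n rmorph1 mulr1 subrr.
Qed.

Lemma missing_frequency_eq0 (s : seq nat) (g : nat -> nat) (c : nat -> C)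
    (k0 : 'I_d) (b0 : nat) :
  uniq s ->
  {in s &, forall a b, g a = g b %[mod d] -> a = b} ->
  {in s, forall a, g a <> b0 %[mod d]} ->
  (forall k : 'I_d, k != k0 -> \sum_(a <- s) c a * z ^+ (g a * k) = 0) ->
  {in s, forall a, c a = 0}.
Proof.
move=> s_uniq g_inj g_missing f0.
pose f k := \sum_(a <- s) c a * z ^+ (g a * k).
(* The Fourier coefficient of [f] at [b], computed twice: by orthogonality, and as the single term
   at [k0]. *)
have fourier b : \sum_(a <- s) c a * (if (g a == b %[mod d])%N then d%:R else 0)
    = f k0 * (z ^+ (b * k0))^*.
  transitivity (\sum_(k < d) f k * (z ^+ (b * k))^*); last first.
    rewrite (bigD1 k0) //= big1 ?addr0 // => k neq_k.
    by rewrite /f f0 // mul0r.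
  under [RHS]eq_bigr => k _ do rewrite mulr_suml.
  rewrite exchange_big /=; apply: eq_bigr => a _.
  rewrite -prim_root_orthogonal mulr_sumr.
  by apply: eq_bigr => k _; rewrite mulrA.
(* At [b0] the left side is 0, while the factor of [f k0] has modulus 1. *)
have fk0 : f k0 = 0.
  have := fourier b0; rewrite big_seq big1 => [/esym/eqP|a sa]; last first.
    by rewrite ifF ?mulr0 //; apply/eqP/g_missing.
  rewrite mulf_eq0 => /orP[/eqP //|/eqP conj0].
  have := prim_root_expr_mulconj (b0 * k0).
  by rewrite conj0 mulr0 => /eqP; rewrite eq_sym oner_eq0.
(* By injectivity of [g] modulo [d], only [d%:R * c a] survives at the frequency [g a]. *)
move=> a sa; have := fourier (g a); rewrite fk0 mul0r (bigD1_seq a) //= eqxx.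
rewrite big_seq_cond big1 ?addr0 => [/eqP|b /andP[sb neq_ba]]; last first.
  rewrite ifF ?mulr0 //; apply/eqP => /(g_inj _ _ sb sa) eq_ba.
  by rewrite eq_ba eqxx in neq_ba.
have d_neq0 : d%:R != 0 :> C by rewrite pnatr_eq0 -lt0n (prim_order_gt0 prim_z).
by rewrite mulf_eq0 (negPf d_neq0) orbF => /eqP.
Qed.

(** Frequencies are arbitrary naturals, so that [a * (N %/ q)] needs no reduction modulo [N]. *)
Definition dft (x : 'rV[C]_d) (j : nat) : C :=
  \sum_(n < d) x 0 n * (z ^+ (j * n))^*.

(** Fourier inversion. *)
Lemma dft_eq0 (x : 'rV[C]_d) : (forall j, (j < d)%N -> dft x j = 0) -> x = 0.
Proof.
move=> x0; apply/rowP => m; rewrite [RHS]mxE.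
have : \sum_(j < d) dft x j * z ^+ (m * j) = x 0 m * d%:R.
  under eq_bigr => j _ do rewrite mulr_suml.
  have inner (n : 'I_d) :
      \sum_(j < d) x 0 n * (z ^+ (j * n))^* * z ^+ (m * j) =
      x 0 n * (if (m == n %[mod d])%N then d%:R else 0).
    rewrite -prim_root_orthogonal mulr_sumr; apply: eq_bigr => j _.
    by rewrite -mulrA [_^* * _]mulrC [(j * n)%N]mulnC.
  rewrite exchange_big (bigD1 m) //= inner eqxx.
  rewrite big1 ?addr0 // => n neq_nm.
  rewrite inner ifF ?mulr0 // !modn_small //.
  by rewrite eq_sym; apply/negbTE.
rewrite big1 => [/esym/eqP|j _]; last by rewrite x0 ?mul0r.
have d_neq0 : d%:R != 0 :> C by rewrite pnatr_eq0 -lt0n (prim_order_gt0 prim_z).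
by rewrite mulf_eq0 (negPf d_neq0) orbF => /eqP.
Qed.

End RootsOfUnity.

(** * The primitive root of unity given by the exponential *)

Section RootExp.
Variable R : realType.

Lemma expiD (s t : R) : expi (s + t) = expi s * expi t.
Proof. by apply/eqP; rewrite eq_complex /= cosD sinD eqxx /= addrC. Qed.

Lemma expi_natr (t : R) (n : nat) : expi (t * n%:R) = expi t ^+ n.
Proof.
elim: n => [|n IHn]; last by rewrite exprSr -IHn -natr1 mulrDr mulr1 expiD.
by rewrite mulr0 /expi cos0 sin0 expr0.
Qed.

Lemma expi_prim_root (N : nat) :
  (0 < N)%N -> N.-primitive_root (expi (2 * pi / N%:R) : R[i]).
Proof.
move=> N_gt0; have N_pos : 0 < N%:R :> R by rewrite ltr0n.
have expiN : expi (2 * pi / N%:R) ^+ N = 1 :> R[i].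
  rewrite -expi_natr divfK ?gt_eqF // mulr_natl.
  by rewrite /expi cos2pi sin2pi.
apply/andP; split=> //; apply/forallP => i; rewrite unity_rootE.
have [->|neq_iN] := eqVneq i.+1 N; first by rewrite expiN eqxx.
apply/eqP/negbTE; apply/eqP; rewrite -expi_natr.
(* Half the angle lies strictly between 0 and [pi], so [sin t] is nonzero and the cosine of the full
   angle cannot be 1. *)
pose t : R := pi * i.+1%:R / N%:R.
have -> : 2 * pi / N%:R * i.+1%:R = t *+ 2 by rewrite /t; field; rewrite gt_eqF.
have sin_t : 0 < sin t.
  apply: sin_gt0_pi; rewrite /t divr_gt0 ?mulr_gt0 ?pi_gt0 ?ltr0Sn //=.
  rewrite ltr_pdivrMr // ltr_pM2l ?pi_gt0 // ltr_nat.
  by rewrite ltn_neqAle neq_iN ltn_ord.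
case=> cos1 _; move: cos1; rewrite cos_mulr2n => cos1.
have := cos2Dsin2 t; have : 0 < sin t ^+ 2 by rewrite exprn_gt0.
by move: (sin t ^+ 2) (cos t ^+ 2) cos1 => s c; lra.
Qed.

End RootExp.

(** * Fourier expansion of Ramanujan sums and robustness *)

Section RamanujanSystem.
Variables (R : realType) (N : nat).
Hypothesis N_gt0 : (0 < N)%N.

Let w : R[i] := expi (2 * pi / N%:R).
Let prim_w : N.-primitive_root w := expi_prim_root R N_gt0.

Definition reduced_residues (q : nat) : seq nat :=
  [seq a <- index_iota 1 q.+1 | coprime a q].

Lemma mem_reduced_residues (q a : nat) :
  (a \in reduced_residues q) = [&& coprime a q, (0 < a)%N & (a <= q)%N].
Proof. by rewrite mem_filter mem_index_iota ltnS. Qed.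

Lemma ramanujan_sumE (q n : nat) : (q %| N)%N ->
  ramanujan_sum R q n%:Z =
    \sum_(a <- reduced_residues q) w ^+ (a * (N %/ q) * n).
Proof.
move=> qN; rewrite /ramanujan_sum big_filter; apply: eq_bigr => a _.
rewrite /w -expi_natr; congr expi.
have q_gt0 : (0 < q)%N := dvdn_gt0 N_gt0 qN.
have NE : N%:R = (N %/ q)%:R * q%:R :> R by rewrite -natrM divnK.
have Nq_gt0 : (0 < N %/ q)%N by rewrite divn_gt0 // dvdn_leq.
rewrite !natrM NE; field.
by rewrite !pnatr_eq0 -!lt0n q_gt0 Nq_gt0.
Qed.

Lemma residue_addn (n : 'I_N) (m : nat) :
  (residue n (n%:Z - m%:Z) + m = n %[mod N])%N.
Proof.
apply/eqP; rewrite -eqz_nat -!modz_nat PoszD /=.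
rewrite gez0_abs ?modz_ge0 ?eqz_nat -?lt0n // modzDml.
by rewrite subrK.
Qed.

Lemma dotmx_circ_shift_ramanujan (q m : nat) (x : 'rV[R[i]]_N) : (q %| N)%N ->
  dotmx x (circ_shift m%:Z (ramanujan_vec R N q)) =
    \sum_(a <- reduced_residues q)
      dft w x (a * (N %/ q)) * w ^+ (a * (N %/ q) * m).
Proof.
move=> qN; rewrite dotmx_sum.
under [RHS]eq_bigr => a _ do rewrite mulr_suml.
rewrite exchange_big /=; apply: eq_bigr => n _.
rewrite !mxE ramanujan_sumE // rmorph_sum mulr_sumr; apply: eq_bigr => a _.
set e := (a * (N %/ q))%N; set r := residue n _.
(* Shifting by [m] only multiplies each character by a constant of modulus 1. *)
have -> : w ^+ (e * n) = w ^+ (e * r) * w ^+ (e * m).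
  rewrite -exprD -mulnDr; apply/eqP; rewrite (eq_prim_root_expr prim_w).
  by rewrite -modnMmr -(residue_addn n m) modnMmr.
rewrite rmorphM /= -!mulrA [(w ^+ (e * m))^* * _]mulrC.
by rewrite (prim_root_expr_mulconj prim_w) mulr1.
Qed.

(** A frequency [j] has order [q = N / gcd(j, N)] in Z_N, so the divisors of [N] together reach
    every Fourier coefficient. *)
Lemma exists_reduced_residue (j : nat) : (j < N)%N ->
  exists q a, [/\ (q %| N)%N, a \in reduced_residues q
    & forall x : 'rV_N, dft w x (a * (N %/ q)) = dft w x j].
Proof.
move=> jN.
have dft_mod (x : 'rV[R[i]]_N) i k : i = k %[mod N] -> dft w x i = dft w x k.
  move=> eq_ik; apply: eq_bigr => n _; congr (_ * _^*).
  apply/eqP; rewrite (eq_prim_root_expr prim_w).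
  by rewrite -modnMml eq_ik modnMml.
(* Representatives start at 1, so frequency 0 is reached as [N], with [q = a = 1]. *)
have [->|j_gt0] := posnP j.
  exists 1%N, 1%N; split; rewrite ?dvd1n //.
  by move=> x; apply: dft_mod; rewrite mul1n divn1 modnn mod0n.
pose g := gcdn j N; have g_gt0 : (0 < g)%N by rewrite gcdn_gt0 j_gt0.
have [gj gN] : (g %| j)%N /\ (g %| N)%N by rewrite dvdn_gcdl dvdn_gcdr.
have Ng_gt0 : (0 < N %/ g)%N by rewrite divn_gt0 // dvdn_leq.
exists (N %/ g)%N, (j %/ g)%N; split.
- by rewrite dvdn_div.
- rewrite mem_reduced_residues divn_gt0 // dvdn_leq //=.
  rewrite leq_div2r ?(ltnW jN) // andbT /coprime.
  by rewrite -(eqn_pmul2r g_gt0) muln_gcdl !divnK // mul1n.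
- have NNg : (N %/ (N %/ g) = g)%N by rewrite -{1}(divnK gN) mulKn.
  by move=> x; rewrite NNg divnK.
Qed.

(** The last hypothesis expresses, through [modNd], that reduction modulo [d] is injective on the
    frequencies of order [q]. *)
Lemma ramanujan_system_robust (p : nat) :
  (p %| N)%N -> (1 < N %/ p)%N ->
  (forall q a b, (q %| N)%N -> coprime a q -> coprime b q ->
     p * a = p * b %[mod q] -> a = b %[mod q])%N ->
  robust_to_erasures (@ramanujan_system R p N) 1.
Proof.
set d := (N %/ p)%N => pN d_gt1 p_inj I /eqP/cards1P[[k0 i0] ->].
have NE : N = (p * d)%N by rewrite mulnC divnK.
have p_gt0 : (0 < p)%N := dvdn_gt0 N_gt0 pN.
have prim_z : d.-primitive_root (w ^+ p).
  by move: (exp_prim_root prim_w p); rewrite (gcdn_idPl pN).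
(* Multiply the congruence by [p] to reach modulus [N], then cancel [N %/ q]. *)
have modNd a b q : (q %| N)%N -> (a * (N %/ q) = b * (N %/ q) %[mod d])%N ->
    (p * a = p * b %[mod q])%N.
  move=> qN /eqP eq_ab; apply/eqP.
  have q_gt0 : (0 < q)%N := dvdn_gt0 N_gt0 qN.
  have Nq_gt0 : (0 < N %/ q)%N by rewrite divn_gt0 // dvdn_leq.
  rewrite -(eqn_pmul2r Nq_gt0) 2!muln_modl [(q * _)%N]mulnC divnK //.
  by rewrite -2!mulnA {2 4}NE -2!muln_modr eqn_pmul2l.
apply: complete_is_frame => x x0.
apply: (dft_eq0 prim_w) => j /exists_reduced_residue[q [a [qN qa <-]]].
have q_gt0 : (0 < q)%N := dvdn_gt0 N_gt0 qN.
have /tnthP[i qE] : q \in in_tuple (divisors N) by rewrite /= -dvdn_divisors.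
pose b0 : nat := (q %| p)%N.
apply: (missing_frequency_eq0 prim_z (k0 := k0) (b0 := b0)
  (g := fun a => (a * (N %/ q))%N) (c := fun a => dft w x (a * (N %/ q)))
  _ _ _ _ qa).
- by rewrite filter_uniq ?iota_uniq.
- move=> {qa a} a b; rewrite !mem_reduced_residues.
  case/and3P=> aq a_gt0 a_le /and3P[bq b_gt0 b_le] /(modNd _ _ _ qN).
  move=> /(p_inj q a b qN aq bq) eq_ab.
  have small c : (0 < c <= q)%N -> c = (if c %% q == 0 then q else c %% q)%N.
    case/andP=> c_gt0; rewrite leq_eqVlt => /orP[/eqP->|c_lt].
      by rewrite modnn.
    by rewrite modn_small // gtn_eqF.
  by rewrite (small a) ?a_gt0 // (small b) ?b_gt0 // eq_ab.
- move=> {qa a} a; rewrite mem_reduced_residues => /and3P[aq _ _].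
  rewrite /b0; have [qp|/negP nqp] := boolP (q %| p)%N.
    rewrite NE -divn_mulAC // mulnA modnMl modn_small //.
  move=> eq_a0; apply: nqp.
  have /(modNd _ _ _ qN)/eqP : (a * (N %/ q) = 0 * (N %/ q) %[mod d])%N.
    by rewrite mul0n.
  rewrite muln0 mod0n -/(dvdn _ _) Gauss_dvdl //.
  by rewrite coprime_sym.
- move=> k neq_k.
  (* Only one index is erased, so for every divisor all shifts other than [k0] remain. *)
  have ki_notin : (k, i) \notin [set (k0, i0)].
    by rewrite inE xpair_eqE (negPf neq_k).
  rewrite -[RHS](x0 (exist _ (k, i) ki_notin)) /ramanujan_system /= -qE.
  rewrite dotmx_circ_shift_ramanujan //; apply: eq_bigr => b _.
  by rewrite -exprM mulnA [(p * _)%N]mulnC -mulnA.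
Qed.

End RamanujanSystem.

(** For [d = 1] the second system has just two vectors in dimension 2, so no erasure is possible;
    hence [1 < d]. *)
Theorem theorem2p24 (R : realType) (N : nat) (hN : (2 <= N)%N) :
  robust_to_erasures (@ramanujan_system R 1 N) 1 /\
  (forall d : nat, odd d -> (1 < d)%N -> N = (2 * d)%N ->
     robust_to_erasures (@ramanujan_system R 2 N) 1).
Proof.
have N_gt0 : (0 < N)%N by exact: ltnW.
split=> [|d d_odd d_gt1 NE]; apply: ramanujan_system_robust => //.
- by rewrite divn1.
- by move=> q a b _ _ _; rewrite !mul1n.
- by rewrite NE dvdn_mulr.
- by rewrite NE mulKn.
move=> q a b qN aq bq eq_ab.
(* For odd [q], 2 is invertible modulo [q]. *)
have [q_odd|q_even] := boolP (odd q).
  apply/eqP; move/eqP: eq_ab; wlog le_ba : a b aq bq / (b <= a)%N => [IH|].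
    case/orP: (leq_total b a) => [|le_ab]; first exact: IH.
    by rewrite eq_sym (eq_sym (a %% q)%N); exact: IH.
  by rewrite !eqn_mod_dvd ?leq_mul // -mulnBr Gauss_dvdr // coprimen2.
(* For [q = 2 * r], [r] is odd: [a] and [b] agree modulo [r], and modulo 2 since both are odd; the
   Chinese remainder theorem concludes. *)
have [r qE] : exists r, q = (2 * r)%N.
  by exists q./2; rewrite mul2n even_halfK.
have odd_coprime c : coprime c q -> odd c.
  by rewrite qE coprimeMr coprimen2 => /andP[].
have r_odd : odd r.
  have : (r %| d)%N by rewrite -(@dvdn_pmul2l 2) // -qE -NE.
  by move=> rd; exact: dvdn_odd rd d_odd.
apply/eqP; rewrite qE chinese_remainder ?coprime2n //.
rewrite !modn2 !odd_coprime //=.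
by move/eqP: eq_ab; rewrite qE -!muln_modr eqn_pmul2l.
Qed.
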